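(* Assume $k = 1$ (a single item). Let $A$ be any implementable allocation rule. Among all payment rules $P$ that implement $A$ and are ex-post individually rational, the winner-pays-bid payment rule $P^{\mathrm{WPB}}$ minimizes $\mathbb E[g(R)]$ for every convex function $g : \mathbb R \to \mathbb R$, where $R = \sum_i P_i(\bm v)$. That is, $\mathbb E[g(\sum_i P_i^{\mathrm{WPB}}(\bm v))] \le \mathbb E[g(\sum_i P_i(\bm v))]$ for every such $P$ and every convex $g$ for which these expectations exist.
   Context: Setting: $n$ risk-neutral unit-demand bidders and $k$ identical items, $1 \le k < n$. Bidder $i$ has private value $v_i \in \mathcal V_i = [0,\bar v_i]$, drawn independently across bidders from a distribution $F_i$ with density $f_i > 0$ on $\mathcal V_i$; $\bm v = (v_1,\dots,v_n)$, $\mathcal V = \prod_i \mathcal V_i$. An allocation rule is a measurable map $A : \mathcal V \to \{0,1\}^n$ with $\sum_i A_i(\bm v) \le k$. Its interim allocation is $x_i(v_i) = \mathbb E[A_i(\bm v) \mid v_i]$, and $A$ is called implementable if every $x_i$ is non-decreasing. Its interim payment function is $z_i(v_i) = v_i x_i(v_i) - \int_0^{v_i} x_i(u)\,du$. A payment rule is a measurable map $P : \mathcal V \to [0,\infty)^n$ (payments are non-negative). $P$ implements $A$ if $(A,P)$ is Bayesian incentive compatible, i.e. $\mathbb E[v_i A_i(\bm v) - P_i(\bm v) \mid v_i] \ge \mathbb E[v_i A_i(v_i',\bm v_{-i}) - P_i(v_i',\bm v_{-i}) \mid v_i]$ for all $i, v_i, v_i'$, and satisfies revenue equivalence $\mathbb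 E[P_i(\bm v) \mid v_i] = z_i(v_i)$ for all $i, v_i$. $P$ is ex-post individually rational if $v_i A_i(\bm v) - P_i(\bm v) \ge 0$ for all $i$ and $\bm v$. The winner-pays-bid (WPB) payment rule is $P_i^{\mathrm{WPB}}(\bm v) = b_i^{\mathrm{WPB}}(v_i) A_i(\bm v)$ with $b_i^{\mathrm{WPB}}(v_i) = z_i(v_i)/x_i(v_i)$ when $x_i(v_i) > 0$ and $b_i^{\mathrm{WPB}}(v_i) = 0$ otherwise. *)

(* Defs.v *)
From HB Require Import structures.
From mathcomp Require Import all_boot all_order all_algebra.
From mathcomp Require Import all_classical all_reals all_analysis.

Set Implicit Arguments.
Unset Strict Implicit.
Unset Printing Implicit Defensive.

Import Order.TTheory GRing.Theory Num.Theory.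
Import numFieldNormedType.Exports.

Local Open Scope classical_set_scope.
Local Open Scope ring_scope.

Definition profile (R : realType) (n : nat) := 'I_n -> R.

Definition in_box (R : realType) (n : nat) (vbar : 'I_n -> R) (v : 'I_n -> R) :=
  forall j, 0 <= v j <= vbar j.

Definition subst (R : realType) (n : nat) (v : 'I_n -> R) (i : 'I_n) (t : R)
  : 'I_n -> R := fun j => if j == i then t else v j.

Definition cylinders (R : realType) (n : nat) : set (set ('I_n -> R)) :=
  [set C | exists i : 'I_n, exists2 B : set R, measurable B &
           C = (fun v => v i) @^-1` B].

Definition profile_measurable (R : realType) (n : nat) (h : ('I_n -> R) -> R) :=
  forall B : set R, measurable B -> <<s (@cylinders R n) >> (h @^-1` B).

Definition allocation_rule (R : realType) (n k : nat) (vbar : 'I_n -> R)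
  (A : ('I_n -> R) -> 'I_n -> bool) :=
  (forall i, profile_measurable (fun v => (A v i)%:R : R)) /\
  (forall v, in_box vbar v -> (\sum_(i < n) (A v i : nat) <= k)%N).

Definition payment_rule (R : realType) (n : nat) (vbar : 'I_n -> R)
  (P : ('I_n -> R) -> 'I_n -> R) :=
  (forall i, profile_measurable (fun v => P v i)) /\
  (forall v, in_box vbar v -> forall i, 0 <= P v i).

Section auction.
Context {R : realType} {d : measure_display} {T : measurableType d}.
Variables (Pr : probability T R) (n : nat) (V : 'I_n -> T -> R).

Definition Vprof (w : T) : 'I_n -> R := fun j => V j w.

(* E[ h(v) | v_i = t ]  (the version given by independence: integrate over
   v_{-i} with v_i fixed at t). *)
Definition cond_exp (h : ('I_n -> R) -> R) (i : 'I_n) (t : R) : \bar R :=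
  (\int[Pr]_w (h (subst (Vprof w) i t))%:E)%E.

Definition interim_alloc (A : ('I_n -> R) -> 'I_n -> bool) (i : 'I_n) (t : R) : R :=
  fine (cond_exp (fun v => (A v i)%:R) i t).

Definition interim_pay (A : ('I_n -> R) -> 'I_n -> bool) (i : 'I_n) (t : R) : R :=
  t * interim_alloc A i t -
  fine (\int[lebesgue_measure]_(u in `[0%R, t]) (interim_alloc A i u)%:E)%E.

Definition implementable (vbar : 'I_n -> R) (A : ('I_n -> R) -> 'I_n -> bool) :=
  forall i, {in `[0, vbar i] &, forall s t, s <= t ->
    interim_alloc A i s <= interim_alloc A i t}.

(* P implements A: Bayesian incentive compatibility + revenue equivalence *)
Definition implements (vbar : 'I_n -> R) (A : ('I_n -> R) -> 'I_n -> bool)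
  (P : ('I_n -> R) -> 'I_n -> R) :=
  (forall i, forall t t', t \in `[0, vbar i] -> t' \in `[0, vbar i] ->
     (cond_exp (fun v => (t * (A v i)%:R - P v i)%R) i t' <=
      cond_exp (fun v => (t * (A v i)%:R - P v i)%R) i t)%E) /\
  (forall i t, t \in `[0, vbar i] ->
     cond_exp (fun v => P v i) i t = (interim_pay A i t)%:E).

Definition ex_post_IR (vbar : 'I_n -> R) (A : ('I_n -> R) -> 'I_n -> bool)
  (P : ('I_n -> R) -> 'I_n -> R) :=
  forall v, in_box vbar v -> forall i, 0 <= v i * (A v i)%:R - P v i.

Definition bid_WPB (A : ('I_n -> R) -> 'I_n -> bool) (i : 'I_n) (t : R) : R :=
  if 0 < interim_alloc A i t then interim_pay A i t / interim_alloc A i t else 0.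

Definition P_WPB (A : ('I_n -> R) -> 'I_n -> bool) : ('I_n -> R) -> 'I_n -> R :=
  fun v i => bid_WPB A i (v i) * (A v i)%:R.

Definition revenue (P : ('I_n -> R) -> 'I_n -> R) (w : T) : R :=
  \sum_(i < n) P (Vprof w) i.

End auction.

Definition mutually_independent {R : realType} {d : measure_display}
  {T : measurableType d} (Pr : probability T R) (n : nat) (V : 'I_n -> T -> R) :=
  forall B : 'I_n -> set R, (forall i, measurable (B i)) ->
    fine (Pr [set w | forall i, B i (V i w)]) =
    \prod_(i < n) fine (Pr (V i @^-1` B i)).

Definition has_density_on {R : realType} {d : measure_display}
  {T : measurableType d} (Pr : probability T R) (X : T -> R) (vbar : R)
  (f : R -> R) :=
  measurable_fun setT f /\
  (forall x, x \in `[0, vbar] -> 0 < f x) /\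
  (forall B : set R, measurable B ->
     Pr (X @^-1` B) = (\int[lebesgue_measure]_(x in B `&` `[0%R, vbar]) (f x)%:E)%E).

(* Main.v *)
Require Import Defs.
From HB Require Import structures.
From mathcomp Require Import all_boot all_order all_algebra.
From mathcomp Require Import all_classical all_reals all_analysis.
From mathcomp Require Import measurable_realfun ring lra.
Import Order.TTheory GRing.Theory Num.Theory.
Import numFieldNormedType.Exports.
Local Open Scope classical_set_scope.
Local Open Scope ring_scope.

(** Non-negativity and ex-post individual rationality force losers to pay
    nothing, so with one item the revenue is the winner's payment.  Let [c] be a
    subgradient of [g], let [x_i] and [z_i] be the interim allocation and payment
    of bidder [i], and let [b_i = z_i / x_i] be the winning bid.  Whoever wins,
      [g(R) >= g(R_WPB) + \sum_i c(b_i(v_i)) (P_i(v) - b_i(v_i) A_i(v))].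
    Given [v_i], the conditional expectation of the [i]-th correction term is
    [c(b_i(v_i)) (z_i(v_i) - b_i(v_i) x_i(v_i)) = 0], so taking expectations gives
    the theorem. *)

Local Notation profile_space R n := (g_sigma_algebraType (@cylinders R n)).

(** * Subgradients of convex functions on the line *)

Lemma convex_three_points (R : realType) (g : R -> R) (x y z : R) :
  convex_function (setT : set R^o) g -> x < y -> y < z ->
  (g y - g x) * (z - y) <= (g z - g y) * (y - x).
Proof.
move=> cg xy yz.
have xz : 0 < z - x by rewrite subr_gt0 (lt_trans xy).
have t0 : 0 <= (z - y) / (z - x) by rewrite divr_ge0 ?(ltW xz)// subr_ge0 ltW.
have t1 : (z - y) / (z - x) <= 1.
  by rewrite ler_pdivrMr// mul1r lerB// ltW.
(* [s] is the weight for which [y = s x + (1 - s) z]. *)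
set s := (z - y) / (z - x) in t0 t1.
have : g (s * x + (1 - s) * z) <= s * g x + (1 - s) * g z :=
  cg (Itv01 t0 t1) x z (in_setT _) (in_setT _).
rewrite /s.
have -> : (z - y) / (z - x) * x + (1 - (z - y) / (z - x)) * z = y.
  by field; rewrite gt_eqF.
have -> : (z - y) / (z - x) * g x + (1 - (z - y) / (z - x)) * g z =
    ((z - y) * g x + (y - x) * g z) / (z - x).
  by field; rewrite gt_eqF.
rewrite ler_pdivlMr//; lra.
Qed.

(** The right derivative serves as [c]: at [x] it is the infimum of the slopes of chords from [x] to
    points on its right. By the three-point inequality every chord slope on the left bounds these
    from below, so the infimum is finite and the inequality holds on both sides of [x]. *)
Lemma convex_subgradient (R : realType) (g : R -> R) :
  convex_function (setT : set R^o) g ->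
  exists c : R -> R, forall x y, g x + c x * (y - x) <= g y.
Proof.
move=> cg.
pose S x := [set s | exists2 z, x < z & s = (g z - g x) / (z - x)].
have lbS x y : y < x -> lbound (S x) ((g x - g y) / (x - y)).
  move=> yx _ [z xz ->]; have := convex_three_points _ _ _ _ _ cg yx xz.
  by rewrite ler_pdivlMr ?subr_gt0// mulrAC ler_pdivrMr ?subr_gt0.
have S0 x : S x !=set0.
  by exists ((g (x + 1) - g x) / (x + 1 - x)), (x + 1); rewrite ?ltrDl.
have hlb x : has_lbound (S x).
  by exists ((g x - g (x - 1)) / (x - (x - 1))); apply: lbS; rewrite gtrBl.
exists (fun x => inf (S x)) => x y; have [xy|yx|->] := ltgtP x y.
- have : inf (S x) <= (g y - g x) / (y - x) by apply: ge_inf => //; exists y.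
  rewrite ler_pdivlMr ?subr_gt0//; lra.
- have : (g x - g y) / (x - y) <= inf (S x).
    by apply: lb_le_inf => //; exact: lbS.
  rewrite ler_pdivrMr ?subr_gt0//; lra.
- by rewrite subrr mulr0 addr0.
Qed.

(** Add the subgradient inequalities at [x] and at [y]. Monotonicity later makes [c] measurable, and
    bounded on the range of the bids. *)
Lemma subgradient_nondecreasing (R : realType) (g c : R -> R) :
  (forall x y, g x + c x * (y - x) <= g y) -> {homo c : x y / x <= y}.
Proof.
move=> gc x y; rewrite le_eqVlt => /predU1P[->//|xy].
have H1 := gc x y; have H2 := gc y x.
have : c x * (y - x) <= c y * (y - x) by lra.
by rewrite ler_pM2r// subr_gt0.
Qed.

(** * The product sigma-algebra on profiles *)

Section profiles.
Context {R : realType} {n : nat}.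

Lemma profile_measurableP (h : ('I_n -> R) -> R) :
  profile_measurable h <->
  measurable_fun [set: profile_space R n] (h : profile_space R n -> R).
Proof.
split=> [mh _ B mB|mh B mB]; first by rewrite setTI; exact: mh.
by rewrite -(setTI (h @^-1` B)); exact: mh.
Qed.

Lemma measurable_coordinate (j : 'I_n) :
  measurable_fun [set: profile_space R n] (fun v : profile_space R n => v j).
Proof.
move=> _ B mB; rewrite setTI; apply: sub_sigma_algebra.
by exists j, B.
Qed.

Lemma measurable_into_profile {d} {Y : measurableType d} (F : Y -> profile_space R n) :
  (forall j, measurable_fun setT (fun y => F y j)) -> measurable_fun setT F.
Proof.
move=> mF.
apply: (@measurability _ _ Y (profile_space R n) setT F (@cylinders R n)) => //.
move=> _ [_ [j [B mB ->]] <-].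
exact: mF.
Qed.

(** Cylinders are not closed under intersection; boxes form a pi-system, as uniqueness of measures
    requires. *)
Definition boxes : set (set ('I_n -> R)) :=
  [set C | exists2 B : 'I_n -> set R, forall j, measurable (B j) &
           C = [set v | forall j, B j (v j)]].

Lemma boxes_setI_closed : setI_closed boxes.
Proof.
move=> _ _ [B mB ->] [C mC ->]; exists (fun j => B j `&` C j).
  by move=> j; exact: measurableI.
apply/seteqP; split => [v [Bv Cv] j //|v BCv].
by split => j; case: (BCv j).
Qed.

Lemma measurable_box (B : 'I_n -> set R) : (forall j, measurable (B j)) ->
  measurable ([set v | forall j, B j (v j)] : set (profile_space R n)).
Proof.
move=> mB; rewrite (_ : [set _ | _] =
    \bigcap_(j in [set: 'I_n]) (fun v : profile_space R n => v j) @^-1` B j);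
  last first.
  by apply/seteqP; split => [v Bv j _|v Bv j]; exact: Bv.
apply: fin_bigcap_measurable => [|j _]; first exact: finite_finset.
by rewrite -[X in measurable X]setTI; exact: measurable_coordinate.
Qed.

(** A cylinder is a box whose other sides are full, and a box is a finite intersection of
    cylinders. *)
Lemma boxes_generate : (measurable : set (set (profile_space R n))) = <<s boxes >>.
Proof.
apply/seteqP; split.
  apply: smallest_sub; first exact: smallest_sigma_algebra.
  move=> _ [i [B mB ->]]; apply: sub_sigma_algebra.
  exists (fun j => if j == i then B else setT) => [j|]; first by case: ifP.
  apply/seteqP; split => [v Bv j /=|v /(_ i)/=]; last by rewrite eqxx.
  by case: eqP => // ->.
apply: smallest_sub; first exact: sigma_algebra_measurable.
by move=> _ [B mB ->]; exact: measurable_box.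
Qed.

Lemma measurable_in_box (vbar : 'I_n -> R) :
  measurable (in_box vbar : set (profile_space R n)).
Proof.
rewrite (_ : in_box vbar = [set v | forall j, `[0, vbar j]%classic (v j)]).
  by apply: (measurable_box (fun j => `[0, vbar j]%classic)) => j.
by apply/seteqP; split => v vb j; have := vb j; rewrite /= in_itv.
Qed.

End profiles.

(** * Independence and conditioning on one coordinate *)

Section independence.
Context {R : realType} {d : measure_display} {T : measurableType d}
  {n : nat}.
Variables (Pr : probability T R) (V : 'I_n -> T -> R).
Hypothesis mV : forall i, measurable_fun setT (V i).

Lemma measurable_Vprof : measurable_fun setT (Vprof V : T -> profile_space R n).
Proof. exact: measurable_into_profile. Qed.

Lemma measurable_subst (i : 'I_n) :
  measurable_fun setT (fun p : R * T => subst (Vprof V p.2) i p.1 : profile_space R n).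
Proof.
apply: measurable_into_profile => j; rewrite /subst /Vprof.
case: (j == i); first exact: measurable_fst.
by apply: measurableT_comp => //; exact: measurable_snd.
Qed.

(* Replacing the [i]-th coordinate of a profile by that of an independent copy does
   not change its law; Fubini then turns [E[h(v)]] into [E[E[h(v) | v_i]]]. *)
Definition resample (i : 'I_n) (p : T * T) : profile_space R n :=
  subst (Vprof V p.2) i (V i p.1).

Lemma measurable_resample (i : 'I_n) : measurable_fun setT (resample i).
Proof.
apply: measurable_into_profile => j; rewrite /resample /subst /Vprof.
by case: (j == i); apply: measurableT_comp.
Qed.

Lemma prob_setT_lty : (Pr setT < +oo)%E.
Proof. by rewrite probability_setT ltry. Qed.

Lemma product_prob_lty : ((Pr \x Pr)%E setT < +oo)%E.
Proof.
rewrite -setXTT product_measure1E//; apply: lte_mul_pinfty => //.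
  exact: fin_num_measure.
by rewrite ltey_eq fin_num_measure.
Qed.

Hypothesis indepV : mutually_independent Pr V.

Lemma independent_prob (B : 'I_n -> set R) : (forall i, measurable (B i)) ->
  Pr [set w | forall i, B i (V i w)] = (\prod_(i < n) fine (Pr (V i @^-1` B i)))%:E.
Proof.
move=> mB; rewrite -indepV// fineK//; apply: fin_num_measure.
have := measurable_Vprof measurableT _ (measurable_box _ mB).
by rewrite setTI.
Qed.

(** Two finite measures that agree on boxes coincide. On a box, independence is applied with side
    [i] made full: this side contributes the factor 1, and the first copy supplies the missing
    factor for [V i]. *)
Lemma resample_law (i : 'I_n) (C : set (profile_space R n)) : measurable C ->
  (Pr \x Pr)%E (resample i @^-1` C) = Pr (Vprof V @^-1` C).
Proof.
move=> mC.
have := (@measure_unique _ R (profile_space R n) (@boxes R n) (fun=> setT) _ _ _ _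
  (pushforward (Pr \x Pr)%E (resample i))
  (pushforward Pr (Vprof V : T -> profile_space R n))); apply => //.
- exact: boxes_generate.
- exact: boxes_setI_closed.
- by move=> _; exists (fun=> setT) => //; apply/seteqP; split.
- by rewrite bigcup_const.
- exact: measurable_resample.
- exact: measurable_Vprof.
- move=> ? ? _ [B mB ->]; rewrite /pushforward/=.
  (* The first copy is constrained through coordinate [i] only, the second through all the others,
     so the preimage of a box is a rectangle. *)
  transitivity ((Pr \x Pr)%E ((V i @^-1` B i) `*`
    [set w | forall j, (if j == i then setT else B j) (V j w)])).
    congr ((Pr \x Pr)%E _); apply/seteqP; split => -[w w'] /=.
      move=> H; split => [|j]; have := H i; rewrite /resample /subst/= ?eqxx//.
      by move=> _; have := H j; rewrite /resample /subst/=; case: eqP.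
    move=> [H1 H2] j; have := H2 j.
    by rewrite /resample /subst/=; case: eqP => // ->.
  have mB' j : measurable (if j == i then setT else B j) by case: ifP.
  have mVB j (S : set R) : measurable S -> measurable (V j @^-1` S).
    by move=> mS; rewrite -[X in measurable X]setTI; exact: mV.
  rewrite product_measure1E/=; last 2 first.
  + exact: mVB.
  + by have := measurable_Vprof measurableT _ (measurable_box _ mB'); rewrite setTI.
  rewrite (independent_prob (fun j => if j == i then setT else B j))//.
  rewrite [RHS](independent_prob B mB).
  rewrite -(fineK (fin_num_measure Pr (V i @^-1` B i) (mVB _ _ (mB i)))) -EFinM.
  congr (_%:E); rewrite (bigD1 i)//= eqxx preimage_setT probability_setT/= mul1r.
  rewrite [RHS](bigD1 i)//=; congr (_ * _).
  by apply: eq_bigr => j /negbTE ->.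
- by move=> *; exact: product_prob_lty.
Qed.

Lemma integrable_bounded_comp {d'} {Y : measurableType d'}
  (mu : {measure set Y -> \bar R})
  (F : Y -> profile_space R n) (H : profile_space R n -> R) (M : R) :
  (mu setT < +oo)%E -> measurable_fun setT F ->
  measurable_fun setT H -> (forall v, `|H v| <= M) ->
  mu.-integrable setT (fun y => (H (F y))%:E).
Proof.
move=> muoo mF mH HM; apply: measurable_bounded_integrable => //.
- exact: measurableT_comp.
- exists M; split; first exact: num_real.
  by move=> x Mx y _; apply: le_trans (ltW Mx); exact: HM.
Qed.

(** The tower property; boundedness of [H] provides the integrability for Fubini. *)
Lemma integral_cond_exp (i : 'I_n) (H : profile_space R n -> R) (M : R) :
  measurable_fun setT H -> (forall v, `|H v| <= M) ->
  (\int[Pr]_w (H (Vprof V w))%:E = \int[Pr]_w cond_exp Pr V H i (V i w))%E.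
Proof.
move=> mH HM.
have mHE : measurable_fun [set: profile_space R n] (EFin \o H).
  by exact/measurable_EFinP.
have intV := integrable_bounded_comp Pr _ _ _ prob_setT_lty measurable_Vprof mH HM.
have intr := integrable_bounded_comp (Pr \x Pr)%E _ _ _ product_prob_lty
  (measurable_resample i) mH HM.
(* Conditioning on [V i w] is by definition the inner Fubini integral of [H] composed with
   [resample i]. *)
rewrite (_ : (fun w => cond_exp _ _ _ _ _) =
  fubini_F Pr (fun p => (H (resample i p))%:E))// integral12_prod_meas1//.
have := integral_pushforward measurable_Vprof mHE (D := setT) intV measurableT.
rewrite preimage_setT => <-.
have := integral_pushforward (measurable_resample i) mHE (D := setT) intr measurableT.
rewrite preimage_setT => <-.
apply: eq_measure_integral; [exact: measurable_resample|exact: measurable_Vprof|].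
by move=> ? ? C mC _; rewrite /pushforward; exact/esym/resample_law.
Qed.

End independence.

(** * Ratios of conditional expectations and the mean-zero correction term *)

Section conditional_ratio.
Context {R : realType} {d : measure_display} {T : measurableType d}
  {n : nat}.
Variables (Pr : probability T R) (V : 'I_n -> T -> R).
Hypothesis mV : forall i, measurable_fun setT (V i).

Lemma measurable_cond_exp (i : 'I_n) (H : profile_space R n -> R) :
  measurable_fun setT H -> (forall v, 0 <= H v) ->
  measurable_fun setT (cond_exp Pr V H i).
Proof.
move=> mH H0.
apply: (@measurable_fun_fubini_tonelli_F _ _ _ _ _ Pr
  (fun p : R * T => (H (subst (Vprof V p.2) i p.1))%:E)).
- apply/measurable_EFinP; apply: (measurableT_comp mH).
  exact: measurable_subst.
- by move=> p; rewrite lee_fin.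
Qed.

Lemma measurable_substl (i : 'I_n) (t : R) :
  measurable_fun setT (fun w => subst (Vprof V w) i t : profile_space R n).
Proof.
apply: measurable_into_profile => j; rewrite /subst /Vprof.
by case: (j == i).
Qed.

Lemma integrable_subst (i : 'I_n) (t : R) (H : profile_space R n -> R) (M : R) :
  measurable_fun setT H -> (forall v, `|H v| <= M) ->
  Pr.-integrable setT (fun w => (H (subst (Vprof V w) i t))%:E).
Proof.
move=> mH HM; apply: integrable_bounded_comp mH HM => //.
  exact: prob_setT_lty.
exact: measurable_substl.
Qed.

Lemma fine_cond_expK (i : 'I_n) (t : R) (H : profile_space R n -> R) (M : R) :
  measurable_fun setT H -> (forall v, `|H v| <= M) ->
  (fine (cond_exp Pr V H i t))%:E = cond_exp Pr V H i t.
Proof.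
move=> mH HM; rewrite fineK//; apply: integrable_fin_num => //.
exact: integrable_subst mH HM.
Qed.

Variables (i : 'I_n) (P A : profile_space R n -> R) (M : R).
Hypotheses (mP : measurable_fun setT P) (mA : measurable_fun setT A).
Hypotheses (A01 : forall v, 0 <= A v <= 1) (PA : forall v, 0 <= P v <= M * A v).
Hypothesis M0 : 0 <= M.

(* Where the denominator vanishes so does the numerator, so MathComp's [x / 0 = 0]
   gives the correct value there. *)
Definition cond_ratio (t : R) : R :=
  fine (cond_exp Pr V P i t) / fine (cond_exp Pr V A i t).

Lemma den_norm_le v : `|A v| <= 1.
Proof. by have /andP[A0 A1] := A01 v; rewrite ger0_norm. Qed.

Lemma num_norm_le v : `|P v| <= M.
Proof.
have /andP[A0 A1] := A01 v; have /andP[P0 P1] := PA v.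
by rewrite ger0_norm// (le_trans P1)// ler_piMr.
Qed.

Let EA t := fine_cond_expK i t _ _ mA den_norm_le.
Let EP t := fine_cond_expK i t _ _ mP num_norm_le.

Lemma cond_exp_den_ge0 t : 0 <= fine (cond_exp Pr V A i t).
Proof.
by apply: fine_ge0; apply: integral_ge0 => w _; rewrite lee_fin;
  case/andP: (A01 (subst (Vprof V w) i t)).
Qed.

Lemma cond_exp_num_ge0 t : 0 <= fine (cond_exp Pr V P i t).
Proof.
by apply: fine_ge0; apply: integral_ge0 => w _; rewrite lee_fin;
  case/andP: (PA (subst (Vprof V w) i t)).
Qed.

Lemma cond_exp_num_le t : fine (cond_exp Pr V P i t) <= M * fine (cond_exp Pr V A i t).
Proof.
rewrite -lee_fin EP EFinM EA -integralZl//; last exact: integrable_subst mA den_norm_le.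
apply: le_integral => //; first exact: integrable_subst mP num_norm_le.
  by apply: integrableZl => //; exact: integrable_subst mA den_norm_le.
by move=> w _; rewrite -EFinM lee_fin; case/andP: (PA (subst (Vprof V w) i t)).
Qed.

Lemma cond_ratio_ge0 t : 0 <= cond_ratio t.
Proof. by rewrite divr_ge0 ?cond_exp_num_ge0 ?cond_exp_den_ge0. Qed.

Lemma cond_ratio_le t : cond_ratio t <= M.
Proof.
rewrite /cond_ratio; have := cond_exp_den_ge0 t; rewrite le_eqVlt.
move=> /predU1P[<-|x0]; first by rewrite invr0 mulr0.
by rewrite ler_pdivrMr// cond_exp_num_le.
Qed.

(** If the denominator is zero, the bound [cond_exp_num_le] squeezes the numerator to zero as
    well. *)
Lemma cond_ratioK t :
  cond_ratio t * fine (cond_exp Pr V A i t) = fine (cond_exp Pr V P i t).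
Proof.
rewrite /cond_ratio; have [x0|x0] := eqVneq (fine (cond_exp Pr V A i t)) 0.
  rewrite x0 mulr0; apply/eqP; rewrite eq_le cond_exp_num_ge0.
  by have := cond_exp_num_le t; rewrite x0 mulr0 => ->.
by rewrite divfK.
Qed.

Lemma measurable_cond_ratio : measurable_fun setT cond_ratio.
Proof.
have mfine (H : profile_space R n -> R) :
    measurable_fun setT H -> (forall v, 0 <= H v) ->
    measurable_fun setT (fun t => fine (cond_exp Pr V H i t)).
  move=> mH H0; apply: measurableT_comp; first exact: fine_measurable.
  exact: measurable_cond_exp.
(* Since the denominator is nonnegative, its inverse is the real power of exponent -1, a measurable
   function; both take the value 0 at 0. *)
rewrite (_ : cond_ratio = (fun t => fine (cond_exp Pr V P i t) *
  (fine (cond_exp Pr V A i t)) `^ (-1))); last first.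
  by apply/funext => t; rewrite powR_inv1// cond_exp_den_ge0.
apply: measurable_funM; first by apply: mfine => // v; case/andP: (PA v).
apply: (measurableT_comp (measurable_powR _)).
by apply: mfine => // v; case/andP: (A01 v).
Qed.

Hypothesis indepV : mutually_independent Pr V.
Variable c : R -> R.
Hypothesis cmono : {homo c : x y / x <= y}.

(** The correction term of a single bidder, with [cond_ratio] in the role of the winning bid. *)
Definition weighted_gap (v : profile_space R n) : R :=
  c (cond_ratio (v i)) * (P v - cond_ratio (v i) * A v).

Lemma measurable_weighted_gap : measurable_fun setT weighted_gap.
Proof.
have mb : measurable_fun [set: profile_space R n]
    (fun v : profile_space R n => cond_ratio (v i)).
  by apply: (measurableT_comp measurable_cond_ratio); exact: measurable_coordinate.
apply: measurable_funM.
  by apply: measurableT_comp mb; exact: nondecreasing_measurable.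
by apply: measurable_funB => //; exact: measurable_funM.
Qed.

(** The ratio lies in [[0, M]], so monotonicity places its image under [c] between [c 0] and [c M];
    the payment and the ratio times [A v] are each at most [M]. *)
Lemma weighted_gap_norm_le v : `|weighted_gap v| <= (`|c 0| + `|c M|) * (M + M).
Proof.
rewrite /weighted_gap; set b := cond_ratio _.
have b0 : 0 <= b := cond_ratio_ge0 _; have bM : b <= M := cond_ratio_le _.
have /andP[A0 A1] := A01 v.
rewrite normrM ler_pM//.
  have := cmono _ _ b0; have := cmono _ _ bM.
  have := ler_norm (c M); have := ler_norm (- c 0); rewrite normrN.
  by rewrite ler_norml => *; have := normr_ge0 (c 0); have := normr_ge0 (c M); lra.
rewrite (le_trans (ler_normB _ _))// lerD ?num_norm_le// normrM !ger0_norm//.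
by rewrite (le_trans _ bM)// ler_piMr.
Qed.

Lemma integrable_weighted_gap :
  Pr.-integrable setT (fun w => (weighted_gap (Vprof V w))%:E).
Proof.
apply: integrable_bounded_comp measurable_weighted_gap weighted_gap_norm_le.
  exact: prob_setT_lty.
exact: measurable_Vprof.
Qed.

Lemma integral_weighted_gap : (\int[Pr]_w (weighted_gap (Vprof V w))%:E = 0)%E.
Proof.
rewrite (integral_cond_exp _ _ mV indepV i _ _ measurable_weighted_gap
  weighted_gap_norm_le).
apply: integral0_eq => w _; set t := V i w; rewrite /cond_exp /weighted_gap.
(* Once coordinate [i] is fixed at [t], the ratio and its image under [c] are constants and leave
   the integral; [cond_ratioK] cancels the rest. *)
have substE x : subst (Vprof V x) i t i = t by rewrite /subst eqxx.
under eq_integral do rewrite !substE.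
set b := cond_ratio t.
under eq_integral do rewrite EFinM EFinB EFinM.
have iA := integrable_subst i t _ _ mA den_norm_le.
have iP := integrable_subst i t _ _ mP num_norm_le.
have iB := integrableZl measurableT b iA.
rewrite (integralZl measurableT (integrableB measurableT iP iB)).
rewrite (integralB measurableT iP iB).
rewrite integralZl//.
have := EA t; have := EP t; rewrite /cond_exp => <- <-.
by rewrite -(EFinM b) -EFinB cond_ratioK subrr mule0.
Qed.

End conditional_ratio.

(** * Discarding the null event that values leave the box *)

Lemma density_prob_support (R : realType) (d : measure_display)
  (T : measurableType d) (Pr : probability T R) (X : T -> R) (b : R) (f : R -> R) :
  has_density_on Pr X b f -> Pr (X @^-1` (~` `[0, b])) = 0%E.
Proof.
move=> [_ [_ ->]]; last exact: measurableC.
by rewrite setICl integral_set0.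
Qed.

Lemma ae_le_integral (R : realType) (d : measure_display)
  (T : measurableType d) (mu : {measure set T -> \bar R}) (f g : T -> \bar R) :
  mu.-integrable setT f -> mu.-integrable setT g ->
  {ae mu, forall x, (f x <= g x)%E} -> (\int[mu]_x f x <= \int[mu]_x g x)%E.
Proof.
move=> fi gi [N [mN N0 fgN]].
rewrite (negligible_integral mN measurableT fi N0).
rewrite (negligible_integral mN measurableT gi N0).
have mTN : measurable (setT `\` N) by exact: measurableD.
apply: le_integral => //.
- exact: integrableS fi.
- exact: integrableS gi.
- by move=> x /[!inE] -[_ Nx]; apply: contrapT => /fgN.
Qed.

(* Payments are only constrained on the box; truncating outside of it, which is a
   null event, makes them bounded everywhere. *)
Definition on_box {R : realType} {n : nat} (vbar : 'I_n -> R)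
  (h : ('I_n -> R) -> R) (v : 'I_n -> R) : R := h v * \1_(in_box vbar) v.

Section restriction.
Context {R : realType} {d : measure_display} {T : measurableType d}
  {n : nat}.
Variables (Pr : probability T R) (V : 'I_n -> T -> R).
Hypothesis mV : forall i, measurable_fun setT (V i).
Context {vbar : 'I_n -> R} {f : 'I_n -> R -> R}.
Hypothesis densV : forall i, has_density_on Pr (V i) (vbar i) (f i).

Lemma ae_in_box : {ae Pr, forall w, in_box vbar (Vprof V w)}.
Proof.
apply: filter_forall => j; exists (V j @^-1` (~` `[0, vbar j])); split.
- by rewrite -[X in measurable X]setTI; apply: mV => //; exact: measurableC.
- exact: density_prob_support (densV j).
- by move=> w /= H; rewrite in_itv.
Qed.

Lemma on_boxE h v : in_box vbar v -> on_box vbar h v = h v.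
Proof. by move=> vb; rewrite /on_box indicE mem_set// mulr1. Qed.

Lemma on_box_out h v : ~ in_box vbar v -> on_box vbar h v = 0.
Proof. by move=> vb; rewrite /on_box indicE memNset// mulr0. Qed.

Lemma measurable_on_box h : profile_measurable h ->
  measurable_fun [set: profile_space R n] (on_box vbar h : profile_space R n -> R).
Proof.
move=> /profile_measurableP mh; apply: measurable_funM => //.
by apply: measurable_indic; exact: measurable_in_box.
Qed.

Lemma in_box_subst i t w : t \in `[0, vbar i] -> in_box vbar (Vprof V w) ->
  in_box vbar (subst (Vprof V w) i t).
Proof.
move=> ti wb j; rewrite /subst; case: eqP => [->|_]; last exact: wb.
by move: ti; rewrite in_itv.
Qed.

(** This holds for every [t] in the interval, not merely almost every one: substitution puts
    coordinate [i] inside its interval, and the other coordinates are almost surely in theirs. *)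
Lemma cond_exp_on_box h i t : profile_measurable h -> t \in `[0, vbar i] ->
  cond_exp Pr V (on_box vbar h) i t = cond_exp Pr V h i t.
Proof.
move=> mh ti; apply: ae_eq_integral => //.
- apply/measurable_EFinP; apply: (measurableT_comp (measurable_on_box _ mh)).
  exact: measurable_substl.
- apply/measurable_EFinP; move/profile_measurableP : mh => mh.
  by apply: (measurableT_comp mh); exact: measurable_substl.
- apply: filterS ae_in_box => w wb _; congr (_%:E).
  by apply: on_boxE; exact: in_box_subst.
Qed.

End restriction.

(** * The pointwise inequality for a single item *)

Section single_item.
Context {R : realType} {n : nat}.
Variables (a : 'I_n -> bool).

Lemma single_winner : (\sum_(i < n) (a i : nat) <= 1)%N ->
  (forall i, a i = false) \/ exists2 i, a i & forall j, j != i -> a j = false.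
Proof.
move=> a1; have [/forallP a0|/forallPn[i /negPn ai]] := boolP [forall i, ~~ a i].
  by left => i; apply: negbTE.
right; exists i => // j ji; move: a1.
by rewrite (bigD1 i)//= ai (bigD1 j)//=; case: (a j).
Qed.

(** Without a winner both sides are [g 0]. With winner [i] only the terms of [i] survive, leaving
    the subgradient inequality at [b i] evaluated at [p i]. This is where having one item matters:
    the revenue is a single payment. *)
Lemma single_winner_subgradient (g c : R -> R) (b p : 'I_n -> R) :
  (forall x y, g x + c x * (y - x) <= g y) ->
  (\sum_(i < n) (a i : nat) <= 1)%N -> (forall i, a i = false -> p i = 0) ->
  g (\sum_(i < n) b i * (a i)%:R) + \sum_(i < n) c (b i) * (p i - b i * (a i)%:R)
  <= g (\sum_(i < n) p i).
Proof.
move=> gc /single_winner[a0|[i ai a0]] p0.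
  rewrite !big1 ?addr0// => i _; rewrite ?p0 ?a0 ?mulr0 ?subrr ?mulr0//.
rewrite !(bigD1 (P := xpredT) i)//= !big1 => [|j /a0 aj|j /a0 aj|j /a0 aj].
- by rewrite ai mulr1 !addr0.
- exact: p0.
- by rewrite p0// aj mulr0 subrr mulr0.
- by rewrite aj mulr0.
Qed.

End single_item.

Theorem mainTheorem2 (R : realType) (d : measure_display) (T : measurableType d)
  (Pr : probability T R) (n : nat) (V : 'I_n -> T -> R)
  (vbar : 'I_n -> R) (f : 'I_n -> R -> R)
  (A : ('I_n -> R) -> 'I_n -> bool) :
  (1 < n)%N ->
  (forall i, 0 < vbar i) ->
  (forall i, measurable_fun setT (V i)) ->
  mutually_independent Pr V ->
  (forall i, has_density_on Pr (V i) (vbar i) (f i)) ->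
  allocation_rule 1 vbar A ->
  implementable Pr V vbar A ->
  forall (P : ('I_n -> R) -> 'I_n -> R),
    payment_rule vbar P ->
    implements Pr V vbar A P ->
    ex_post_IR vbar A P ->
  forall g : R -> R,
    convex_function (setT : set R^o) g ->
    Pr.-integrable setT (fun w => (g (revenue V (P_WPB Pr V A) w))%:E) ->
    Pr.-integrable setT (fun w => (g (revenue V P w))%:E) ->
    (\int[Pr]_w (g (revenue V (P_WPB Pr V A) w))%:E <=
     \int[Pr]_w (g (revenue V P w))%:E)%E.
Proof.
move=> _ vbar0 mV indepV densV [mA A1] _ P [mP P0] [_ PE] IR g cg iWPB iP.
have [c gc] := convex_subgradient _ _ cg.
have cmono := subgradient_nondecreasing _ _ _ gc.
pose Ab i := on_box vbar (fun v => (A v i)%:R : R).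
pose Pb i := on_box vbar (fun v => P v i).
have mAb i := measurable_on_box (vbar := vbar) _ (mA i).
have mPb i := measurable_on_box (vbar := vbar) _ (mP i).
have Ab01 i v : 0 <= Ab i v <= 1.
  have [vb|vb] := pselect (in_box vbar v); last by rewrite /Ab on_box_out// lexx ler01.
  by rewrite /Ab on_boxE//; case: (A v i); rewrite ?lexx ler01.
(* On the box the upper bound is ex-post individual rationality with [v i <= vbar i]; outside it
   both sides vanish. *)
have Pb_le i v : 0 <= Pb i v <= vbar i * Ab i v.
  have [vb|vb] := pselect (in_box vbar v); last first.
    by rewrite /Ab /Pb !on_box_out// mulr0 lexx.
  rewrite /Ab /Pb !on_boxE// P0//=; have := IR v vb i; rewrite subr_ge0.
  move=> /le_trans; apply; apply: ler_wpM2r; first by case: (A v i).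
  by case/andP: (vb i).
have vbar_ge0 i : 0 <= vbar i := ltW (vbar0 i).
pose b i := cond_ratio Pr V i (Pb i) (Ab i).
(* By revenue equivalence the conditional mean of the payment is [interim_pay], whichever [P] is
   chosen, so the ratio built from [P] is the winner-pays-bid bid. Where the interim allocation is
   zero, both are 0. *)
have bidE i t : t \in `[0, vbar i] -> bid_WPB Pr V A i t = b i t.
  move=> ti; rewrite /bid_WPB /b /cond_ratio /interim_alloc.
  have EA := cond_exp_on_box _ _ mV densV _ _ _ (mA i) ti.
  have EP := cond_exp_on_box _ _ mV densV _ _ _ (mP i) ti.
  rewrite /Ab /Pb EA EP PE//=; case: ltP => // x0.
  have := cond_exp_den_ge0 Pr V i _ (Ab01 i) t; rewrite EA => x1.
  have -> : fine (cond_exp Pr V (fun v => (A v i)%:R) i t) = 0.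
    by apply/eqP; rewrite eq_le x0.
  by rewrite invr0 mulr0.
pose K i w := weighted_gap Pr V i (Pb i) (Ab i) c (Vprof V w).
have iK i : Pr.-integrable setT (fun w => (K i w)%:E).
  exact: (integrable_weighted_gap _ _ mV _ _ _ _ (mPb i) (mAb i) (Ab01 i) (Pb_le i)
    (vbar_ge0 i) _ cmono).
have K0 i : (\int[Pr]_w (K i w)%:E = 0)%E.
  exact: (integral_weighted_gap _ _ mV _ _ _ _ (mPb i) (mAb i) (Ab01 i) (Pb_le i)
    (vbar_ge0 i) indepV _ cmono).
have iS : Pr.-integrable setT (fun w => \sum_(i < n) (K i w)%:E)%E.
  by apply: integrable_sum.
(* Adding the mean-zero corrections on the left reduces the comparison of integrals to an almost
   sure pointwise inequality. *)
rewrite -[leLHS]adde0 -[X in (_ + X)%E](_ : (\int[Pr]_w \sum_(i < n) (K i w)%:E = 0)%E);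
  last by rewrite integral_sum// big1.
rewrite -integralD//; apply: ae_le_integral => //; first exact: integrableD.
apply: filterS (ae_in_box _ _ mV densV) => w wb.
rewrite sumEFin -EFinD lee_fin /revenue.
have := single_winner_subgradient (A (Vprof V w)) _ _ (fun i => b i (V i w))
  (P (Vprof V w)) gc (A1 _ wb).
have KE i : K i w =
    c (b i (V i w)) * (P (Vprof V w) i - b i (V i w) * (A (Vprof V w) i)%:R).
  by rewrite /K /weighted_gap /Pb /Ab !on_boxE.
rewrite (eq_bigr _ (fun i _ => KE i)).
have -> : \sum_(i < n) P_WPB Pr V A (Vprof V w) i =
    \sum_(i < n) b i (V i w) * (A (Vprof V w) i)%:R.
  by apply: eq_bigr => i _; rewrite /P_WPB bidE// in_itv; exact: wb.
(* A loser pays at most 0 by individual rationality and at least 0 by non-negativity. *)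
apply=> i Ai; apply/eqP; rewrite eq_le P0// andbT.
by have := IR _ wb i; rewrite Ai mulr0 sub0r oppr_ge0.
Qed.
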